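(* A functor is semiseparable if and only if it factors as $S\circ N$ where $S$ is a separable functor and $N$ is a naturally full functor.
   Context: For a functor $F:\mathcal{C}\to\mathcal{D}$ let $\mathcal{F}^F:\mathrm{Hom}_{\mathcal{C}}(-,-)\to\mathrm{Hom}_{\mathcal{D}}(F-,F-)$ be the natural transformation (of functors $\mathcal{C}^{\mathrm{op}}\times\mathcal{C}\to\mathsf{Set}$) with $\mathcal{F}^F_{X,Y}(f)=F(f)$. $F$ is separable if there is a natural transformation $\mathcal{P}^F:\mathrm{Hom}_{\mathcal{D}}(F-,F-)\to\mathrm{Hom}_{\mathcal{C}}(-,-)$ with $\mathcal{P}^F\circ\mathcal{F}^F=\mathrm{Id}$; naturally full if there is such a $\mathcal{P}^F$ with $\mathcal{F}^F\circ\mathcal{P}^F=\mathrm{Id}$; semiseparable if there is such a $\mathcal{P}^F$ with $\mathcal{F}^F\circ\mathcal{P}^F\circ\mathcal{F}^F=\mathcal{F}^F$. *)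

(* Defs.v *)
From Stdlib Require Import FunctionalExtensionality.

Set Implicit Arguments.
Unset Strict Implicit.
Unset Printing Implicit Defensive.

#[local] Obligation Tactic := cbn; intros; try reflexivity.

Declare Scope cat_scope.
Delimit Scope cat_scope with cat.

Record category := Category {
  ob :> Type;
  hom : ob -> ob -> Type;
  idm : forall X, hom X X;
  comp : forall X Y Z, hom Y Z -> hom X Y -> hom X Z;
  comp_idl : forall X Y (f : hom X Y), comp (idm Y) f = f;
  comp_idr : forall X Y (f : hom X Y), comp f (idm X) = f;
  compA : forall X Y Z W (h : hom Z W) (g : hom Y Z) (f : hom X Y),
    comp h (comp g f) = comp (comp h g) f }.

Arguments hom {c} X Y.
Arguments idm {c} X.
Arguments comp {c X Y Z} g f.

Notation "g ∘ f" := (comp g f) (at level 40, left associativity) : cat_scope.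
Local Open Scope cat_scope.

Record functor (C D : category) := Functor {
  fob :> C -> D;
  fmap : forall X Y : C, hom X Y -> hom (fob X) (fob Y);
  fmap_id : forall X : C, fmap (idm X) = idm (fob X);
  fmap_comp : forall (X Y Z : C) (g : hom Y Z) (f : hom X Y),
    fmap (g ∘ f) = fmap g ∘ fmap f }.

Arguments fmap {C D} F {X Y} f : rename.

Program Definition functor_comp (C D E : category)
    (G : functor D E) (F : functor C D) : functor C E :=
  {| fob := fun X => G (F X); fmap := fun X Y f => fmap G (fmap F f) |}.
Next Obligation. now rewrite !fmap_id. Qed.
Next Obligation. now rewrite !fmap_comp. Qed.

Record nattrans (C D : category) (F G : functor C D) := NatTrans {
  ntc :> forall X : C, hom (F X) (G X);
  ntc_natural : forall (X Y : C) (f : hom X Y),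
    fmap G f ∘ ntc X = ntc Y ∘ fmap F f }.

Program Definition nattrans_id (C D : category) (F : functor C D) :
    nattrans F F :=
  {| ntc := fun X => idm (F X) |}.
Next Obligation. now rewrite comp_idl, comp_idr. Qed.

Program Definition nattrans_comp (C D : category) (F G H : functor C D)
    (b : nattrans G H) (a : nattrans F G) : nattrans F H :=
  {| ntc := fun X => b X ∘ a X |}.
Next Obligation. now rewrite compA, ntc_natural, <- !compA, ntc_natural. Qed.

Program Definition opposite (C : category) : category :=
  {| ob := C; hom := fun X Y => @hom C Y X; idm := fun X => @idm C X;
     comp := fun X Y Z g f => @comp C Z Y X f g |}.
Next Obligation. apply comp_idr. Qed.
Next Obligation. apply comp_idl. Qed.
Next Obligation. symmetry; apply compA. Qed.

Program Definition product (C D : category) : category :=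
  {| ob := (ob C * ob D)%type;
     hom := fun X Y => (hom (fst X) (fst Y) * hom (snd X) (snd Y))%type;
     idm := fun X => (idm (fst X), idm (snd X));
     comp := fun X Y Z g f => (fst g ∘ fst f, snd g ∘ snd f) |}.
Next Obligation. rewrite !comp_idl; now destruct f. Qed.
Next Obligation. rewrite !comp_idr; now destruct f. Qed.
Next Obligation. now rewrite !compA. Qed.

Program Definition functor_op (C D : category) (F : functor C D) :
    functor (opposite C) (opposite D) :=
  {| fob := fun X : opposite C => (F X : opposite D);
     fmap := fun X Y f => @fmap C D F Y X f |}.
Next Obligation. apply fmap_id. Qed.
Next Obligation. apply fmap_comp. Qed.

Program Definition functor_prod (C C' D D' : category)
    (F : functor C D) (F' : functor C' D') :
    functor (product C C') (product D D') :=
  {| fob := fun X : product C C' => ((F (fst X), F' (snd X)) : product D D');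
     fmap := fun X Y f => (fmap F (fst f), fmap F' (snd f)) |}.
Next Obligation. now rewrite !fmap_id. Qed.
Next Obligation. now rewrite !fmap_comp. Qed.

(* The category of sets, a set being a type with Leibniz equality. *)
Program Definition SetCat : category :=
  {| ob := Type; hom := fun A B => A -> B; idm := fun A x => x;
     comp := fun A B C g f x => g (f x) |}.

Program Definition hom_functor (C : category) :
    functor (product (opposite C) C) SetCat :=
  {| fob := fun X : product (opposite C) C =>
       (@hom C (fst X) (snd X) : SetCat);
     fmap := fun X Y (uv : hom X Y) (f : @hom C (fst X) (snd X)) =>
       ((snd uv : @hom C (snd X) (snd Y)) ∘ f)
         ∘ (fst uv : @hom C (fst Y) (fst X)) |}.
Next Obligation.
  apply functional_extensionality; intro h; cbn.
  now rewrite comp_idr, comp_idl.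
Qed.
Next Obligation.
  apply functional_extensionality; intro h; cbn.
  now rewrite !compA.
Qed.

(* Hom_D(F-, F-) *)
Definition hom_functor_along (C D : category) (F : functor C D) :
    functor (product (opposite C) C) SetCat :=
  functor_comp (hom_functor D) (functor_prod (functor_op F) F).

Program Definition hom_map (C D : category) (F : functor C D) :
    nattrans (hom_functor C) (hom_functor_along F) :=
  {| ntc := fun X (f : @hom C (fst X) (snd X)) => fmap F f |}.
Next Obligation.
  apply functional_extensionality; intro h; cbn.
  now rewrite !fmap_comp.
Qed.

Definition separable (C D : category) (F : functor C D) : Prop :=
  exists P : nattrans (hom_functor_along F) (hom_functor C),
    nattrans_comp P (hom_map F) = nattrans_id (hom_functor C).

Definition naturally_full (C D : category) (F : functor C D) : Prop :=
  exists P : nattrans (hom_functor_along F) (hom_functor C),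
    nattrans_comp (hom_map F) P = nattrans_id (hom_functor_along F).

Definition semiseparable (C D : category) (F : functor C D) : Prop :=
  exists P : nattrans (hom_functor_along F) (hom_functor C),
    nattrans_comp (nattrans_comp (hom_map F) P) (hom_map F) = hom_map F.

(* Main.v *)
From Stdlib Require Import FunctionalExtensionality ProofIrrelevance Setoid.
Require Import Defs.

(** For a semiseparable functor F with weak section P, factor F through its
    image E: the objects of E are those of C and its morphisms X -> Y are the
    morphisms F X -> F Y of D of the form F f.  On E the identity F P F = F
    says that F P g = g, so P itself exhibits C -> E as naturally full, while
    g |-> F (P g) exhibits E -> D as separable.  Conversely, if F = S N then
    P := P^N o P^S satisfies S N P^N P^S S N = S N. *)

Local Open Scope cat_scope.

(** The laws are propositions, so proof irrelevance identifies functors that differ only in their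
    law proofs. *)
Lemma functor_eta (C D : category) (F : functor C D) i c :
  F = @Functor C D F (fun X Y f => fmap F f) i c.
Proof.
  destruct F as [fo fm i' c'].
  now rewrite (proof_irrelevance _ i i'), (proof_irrelevance _ c c').
Qed.

Lemma bifunctor_nattrans_eqP (C : category)
    (F G : functor (product (opposite C) C) SetCat) (a b : nattrans F G) :
  a = b <-> forall (X Y : C) f, ntc a (X, Y) f = ntc b (X, Y) f.
Proof.
  split; [now intros -> |].
  destruct a as [a na], b as [b nb]; simpl; intro ab.
  assert (a = b) as ->.
  { apply functional_extensionality_dep; intros [X Y].
    apply functional_extensionality; apply ab. }
  now rewrite (proof_irrelevance _ na nb).
Qed.

(** Naturality in both variables at once, with the opposite and product categories unfolded. *)
Definition hom_natural (C D : category) (F : functor C D)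
    (p : forall X Y : C, hom (F X) (F Y) -> hom X Y) : Prop :=
  forall (X X' Y Y' : C) (u : hom X' X) (v : hom Y Y') (g : hom (F X) (F Y)),
    p X' Y' (fmap F v ∘ g ∘ fmap F u) = v ∘ p X Y g ∘ u.

(** The naturality square at [(u, v)], evaluated at [g], is the equation of [hom_natural] read
    backwards. Leaving [Q] arbitrary lets one lemma serve all three notions. *)
Lemma hom_nattransP (C D : category) (F : functor C D)
    (Q : (forall X Y : C, hom (F X) (F Y) -> hom X Y) -> Prop) :
  (exists P : nattrans (hom_functor_along F) (hom_functor C),
      Q (fun X Y => P (X, Y))) <->
  (exists p, hom_natural C D F p /\ Q p).
Proof.
  split.
  - intros [P HP]; exists (fun X Y => P (X, Y)); split; [|exact HP].
    intros X X' Y Y' u v g.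
    symmetry.
    exact (equal_f (@ntc_natural _ _ _ _ P (X, Y) (X', Y') (u, v)) g).
  - intros [p [np Hp]].
    unshelve eexists.
    + exists (fun X g => p (fst X) (snd X) g).
      intros X Y uv; apply functional_extensionality; intro g.
      symmetry; apply np.
    (* [Q] sees the components only at literal pairs, where [fst] and [snd] reduce. *)
    + exact Hp.
Qed.

Lemma separableP (C D : category) (F : functor C D) :
  separable F <->
  exists p, hom_natural C D F p /\
    forall (X Y : C) (f : hom X Y), p X Y (fmap F f) = f.
Proof.
  rewrite <- hom_nattransP.
  split; intros [P HP]; exists P.
  - exact (proj1 (bifunctor_nattrans_eqP _ _ _ _ _) HP).
  - apply bifunctor_nattrans_eqP; exact HP.
Qed.

Lemma naturally_fullP (C D : category) (F : functor C D) :
  naturally_full F <->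
  exists p, hom_natural C D F p /\
    forall (X Y : C) (g : hom (F X) (F Y)), fmap F (p X Y g) = g.
Proof.
  rewrite <- hom_nattransP.
  split; intros [P HP]; exists P.
  - exact (proj1 (bifunctor_nattrans_eqP _ _ _ _ _) HP).
  - apply bifunctor_nattrans_eqP; exact HP.
Qed.

Lemma semiseparableP (C D : category) (F : functor C D) :
  semiseparable F <->
  exists p, hom_natural C D F p /\
    forall (X Y : C) (f : hom X Y), fmap F (p X Y (fmap F f)) = fmap F f.
Proof.
  rewrite <- hom_nattransP.
  split; intros [P HP]; exists P.
  - exact (proj1 (bifunctor_nattrans_eqP _ _ _ _ _) HP).
  - apply bifunctor_nattrans_eqP; exact HP.
Qed.

Section Image.
Variables (C D : category) (F : functor C D).

(** The preimage is only asserted to exist, not stored: morphisms are then equal as soon as their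
    values in [D] are, which makes [of_image] faithful. *)
Definition image_hom (X Y : C) : Type :=
  {g : hom (F X) (F Y) | exists f : hom X Y, fmap F f = g}.

Lemma image_hom_ext (X Y : C) (g h : image_hom X Y) :
  proj1_sig g = proj1_sig h -> g = h.
Proof.
  apply eq_sig_hprop; intros; apply proof_irrelevance.
Qed.

Definition image_map (X Y : C) (f : hom X Y) : image_hom X Y :=
  exist _ (fmap F f) (ex_intro _ f eq_refl).

Definition image_comp (X Y Z : C) (h : image_hom Y Z) (g : image_hom X Y) :
  image_hom X Z.
Proof.
  exists (proj1_sig h ∘ proj1_sig g).
  destruct h as [h [h' <-]], g as [g [g' <-]].
  exists (h' ∘ g'); apply fmap_comp.
Defined.

Definition image_cat : category.
Proof.
  refine {| ob := ob C; hom := image_hom;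
            idm := fun X => image_map X X (idm X); comp := image_comp |};
    intros; apply image_hom_ext; simpl.
  - now rewrite fmap_id, comp_idl.
  - now rewrite fmap_id, comp_idr.
  - apply compA.
Defined.

Definition to_image : functor C image_cat.
Proof.
  refine (@Functor C image_cat (fun X => X) image_map _ _);
    intros; apply image_hom_ext; simpl.
  - reflexivity.
  - apply fmap_comp.
Defined.

Definition of_image : functor image_cat D.
Proof.
  refine (@Functor image_cat D (fun X => F X)
            (fun X Y (g : image_hom X Y) => proj1_sig g) _ _).
  - intro X; apply fmap_id.
  - reflexivity.
Defined.

Lemma image_factorization : F = functor_comp of_image to_image.
Proof.
  exact (functor_eta C D F _ _).
Qed.

Variable p : forall X Y : C, hom (F X) (F Y) -> hom X Y.
Hypothesis p_natural : hom_natural C D F p.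
Hypothesis p_weak_section :
  forall (X Y : C) (f : hom X Y), fmap F (p X Y (fmap F f)) = fmap F f.

Lemma to_image_naturally_full : naturally_full to_image.
Proof.
  apply naturally_fullP.
  exists (fun (X Y : C) (g : image_hom X Y) => p X Y (proj1_sig g)); split.
  - intros X X' Y Y' u v g; apply p_natural.
  - intros X Y [g [f <-]]; apply image_hom_ext; apply p_weak_section.
Qed.

Lemma of_image_separable : separable of_image.
Proof.
  apply separableP.
  exists (fun (X Y : C) (g : hom (F X) (F Y)) => image_map X Y (p X Y g)); split.
  (* Naturality is now tested against morphisms of the image, so preimages [u'] and [v'] in [C] are
     chosen before [p_natural] can apply. *)
  - intros X X' Y Y' [u [u' <-]] [v [v' <-]] g; apply image_hom_ext; simpl.
    rewrite p_natural; now rewrite !fmap_comp.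
  - intros X Y [g [f <-]]; apply image_hom_ext; apply p_weak_section.
Qed.

End Image.

Theorem corollary1p16 (C D : category) (F : functor C D) :
  semiseparable F <->
  exists (E : category) (N : functor C E) (S : functor E D),
    separable S /\ naturally_full N /\ F = functor_comp S N.
Proof.
  split.
  - intros [p [np Hp]]%semiseparableP.
    exists (image_cat C D F), (to_image C D F), (of_image C D F).
    split; [|split].
    + exact (of_image_separable C D F p np Hp).
    + exact (to_image_naturally_full C D F p np Hp).
    + apply image_factorization.
  - intros (E & N & S & [s [ns Hs]]%separableP & [n [nn Hn]]%naturally_fullP & ->).
    apply semiseparableP.
    exists (fun X Y g => n X Y (s (N X) (N Y) g)); split.
    + intros X X' Y Y' u v g; simpl.
      (* [ns] is used at [fmap N u] and [fmap N v], which yields exactly the form that [nn]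
         expects. *)
      now rewrite ns, nn.
    + intros X Y f; simpl.
      (* [Hs] reduces [s] of [S (N f)] to [N f]; then [Hn] at [N f] removes [N] after [n]. *)
      now rewrite Hs, Hn.
Qed.
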